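(* Let $K$ be a field and let $m$ be a positive integer. Then the ideal $I=(x_1,\ldots,x_n)^m\subset K[x_1,\ldots,x_n]$ is Freiman if and only if $m=1$, or $n\le 2$, or $n=3$ and $m=2$.
   Context: $\mathfrak m=(x_1,\ldots,x_n)\subset S=K[x_1,\ldots,x_n]$. For a graded ideal $I\subset S$, $\mu(I)$ denotes the minimal number of generators of $I$; the fiber cone is $F(I)=\bigoplus_{k\ge 0} I^k/\mathfrak m I^k$, and the analytic spread $\ell(I)$ is the Krull dimension of $F(I)$. A monomial ideal $I$ that is equigenerated (minimally generated by monomials of one degree) is called Freiman if $\mu(I^2)=\ell(I)\mu(I)-\binom{\ell(I)}{2}$. *)

(* Defs.v *)
From HB Require Import structures.
From mathcomp Require Import all_boot all_algebra.
From mathcomp Require Import ring_quotient boolp mpoly.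

Set Implicit Arguments.
Unset Strict Implicit.
Unset Printing Implicit Defensive.

Import GRing.Theory.
Local Open Scope ring_scope.

(* MathComp's [idealr] only covers proper ideals; here the whole ring is allowed,
   since it is the zeroth power of any ideal. Ideals are compared with [=i]. *)
Definition ideal_closed (R : comNzRingType) (I : {pred R}) : Prop :=
  0 \in I /\ forall a, {in I &, forall u v, a * u + v \in I}.

Record ideal (R : comNzRingType) := Ideal {
  ideal_mem :> {pred R};
  ideal_memP : ideal_closed ideal_mem
}.

Section IdealTheory.
Variables (R : comNzRingType) (I : ideal R).

Lemma ideal0 : 0 \in I. Proof. by case: (ideal_memP I). Qed.

Lemma idealD u v : u \in I -> v \in I -> u + v \in I.
Proof.
by move=> Iu Iv; case: (ideal_memP I) => _ /(_ 1 u v Iu Iv); rewrite mul1r.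
Qed.

Lemma idealMl a u : u \in I -> a * u \in I.
Proof.
move=> Iu; case: (ideal_memP I) => I0 /(_ a u 0 Iu I0).
by rewrite addr0.
Qed.

Lemma idealN u : u \in I -> - u \in I.
Proof. by rewrite -mulN1r; apply: idealMl. Qed.

Lemma ideal_sum (T : Type) (s : seq T) (P : pred T) (F : T -> R) :
  (forall i, P i -> F i \in I) -> \sum_(i <- s | P i) F i \in I.
Proof.
by move=> IF; apply: (big_ind (fun x => x \in I)) => //;
   [exact: ideal0 | exact: idealD].
Qed.

End IdealTheory.

Section IdealOperations.
Variable R : comNzRingType.

Lemma ideal_full_closed : ideal_closed (predT : {pred R}).
Proof. by split. Qed.
Definition ideal_full := Ideal ideal_full_closed.

Definition ideal_gen_mem (s : seq R) : {pred R} :=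
  fun x => `[< exists c : 'I_(size s) -> R, x = \sum_i c i * s`_i >].

Lemma ideal_gen_closed s : ideal_closed (ideal_gen_mem s).
Proof.
split=> [|a u v /asboolP[c ->] /asboolP[d ->]]; apply/asboolP.
  by exists (fun=> 0); rewrite big1 // => i _; rewrite mul0r.
exists (fun i => a * c i + d i).
rewrite mulr_sumr -big_split /=; apply: eq_bigr => i _.
by rewrite mulrDl mulrA.
Qed.
Definition ideal_gen s := Ideal (ideal_gen_closed s).

Definition ideal_mul_mem (I J : ideal R) : {pred R} :=
  fun x => `[< exists2 s : seq (R * R),
    all (fun ab => (ab.1 \in I) && (ab.2 \in J)) s &
    x = \sum_(ab <- s) ab.1 * ab.2 >].

Lemma ideal_mul_closed I J : ideal_closed (ideal_mul_mem I J).
Proof.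
split=> [|a u v /asboolP[s sIJ ->] /asboolP[t tIJ ->]]; apply/asboolP.
  by exists [::]; rewrite ?big_nil.
exists ([seq (a * ab.1, ab.2) | ab <- s] ++ t).
  rewrite all_cat tIJ andbT all_map; apply: sub_all sIJ => -[b c] /= /andP[Ib ->].
  by rewrite idealMl.
rewrite big_cat big_map /= mulr_sumr; congr (_ + _).
by apply: eq_bigr => i _; rewrite mulrA.
Qed.
Definition ideal_mul I J := Ideal (ideal_mul_closed I J).

Fixpoint ideal_pow (I : ideal R) (k : nat) : ideal R :=
  if k is k'.+1 then ideal_mul I (ideal_pow I k') else ideal_full.

Lemma ideal_mulMl (I J : ideal R) a b :
  a \in I -> b \in J -> a * b \in ideal_mul I J.
Proof.
move=> Ia Jb; apply/asboolP; exists [:: (a, b)]; first by rewrite /= Ia Jb.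
by rewrite big_seq1.
Qed.

Lemma ideal_powM (I : ideal R) j k a b :
  a \in ideal_pow I j -> b \in ideal_pow I k -> a * b \in ideal_pow I (j + k).
Proof.
elim: j a => [|j IHj] a /= Ia Ib; first exact: idealMl.
have [s sP ->] := asboolW Ia; rewrite mulr_suml big_seq.
apply: (ideal_sum (I := ideal_mul I (ideal_pow I (j + k)))) => -[c d].
move=> /(allP sP) /= /andP[Ic Id].
by rewrite -mulrA; apply: ideal_mulMl => //; apply: IHj.
Qed.

(* [is_mu I r] means mu(I) = r, and likewise for [is_krull_dim] and
   [is_analytic_spread]: as relations, they need no junk value for ideals that
   are not finitely generated or for rings of infinite dimension. *)
Definition is_mu (I : ideal R) (r : nat) : Prop :=
  (exists2 s : seq R, I =i ideal_gen s & size s = r) /\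
  (forall s : seq R, I =i ideal_gen s -> (r <= size s)%N).

Definition prime_ideal (P : {pred R}) : Prop :=
  idealr_closed P /\ prime_idealr_closed P.

Definition prime_chain (d : nat) (P : nat -> {pred R}) : Prop :=
  (forall i, (i <= d)%N -> prime_ideal (P i)) /\
  (forall i, (i < d)%N -> {subset P i <= P i.+1} /\ ~ (P i =i P i.+1)).

Definition is_krull_dim (d : nat) : Prop :=
  (exists P, prime_chain d P) /\ (forall e P, prime_chain e P -> (e <= d)%N).

End IdealOperations.

Arguments is_krull_dim R d : clear implicits.

Section FiberCone.
Variables (K : fieldType) (n : nat).
Local Notation S := {mpoly K[n]}.

Definition maxideal : ideal S := ideal_gen [seq 'X_i | i <- enum 'I_n].

Lemma maxideal_proper : 1 \notin maxideal.
Proof.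
apply/asboolP => -[c /(congr1 (meval (fun=> 0)))].
rewrite rmorph1 rmorph_sum big1 => [/eqP|i _ /=]; first by rewrite oner_eq0.
have : [seq 'X_i | i <- enum 'I_n]`_i \in [seq 'X_i : S | i <- enum 'I_n].
  by apply: mem_nth.
by case/mapP => j _ ->; rewrite rmorphM /= mevalXU mulr0.
Qed.

Variable I : ideal S.

(* The Rees algebra, as the subring of S[t] of the polynomials whose coefficient
   of t^k lies in I^k for every k. *)
Definition rees_mem : {pred {poly S}} :=
  fun p => `[< forall k, p`_k \in ideal_pow I k >].

Lemma rees_subring_closed : subring_closed rees_mem.
Proof.
split=> [|p q /asboolP Ip /asboolP Iq|p q /asboolP Ip /asboolP Iq];
  apply/asboolP => k.
- by rewrite coef1; case: k => [|k] //=; exact: ideal0 (ideal_pow I k.+1).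
- by rewrite coefB idealD // idealN.
rewrite coefM; apply: ideal_sum => i _.
by have := ideal_powM (Ip i) (Iq (k - i)%N); rewrite subnKC // -ltnS.
Qed.

HB.instance Definition _ :=
  GRing.isSubringClosed.Build {poly S} rees_mem rees_subring_closed.

Record rees : Type := Rees {
  rees_val :> {poly S};
  rees_valP : rees_val \in rees_mem
}.

HB.instance Definition _ := [isSub for rees_val].
HB.instance Definition _ := [Choice of rees by <:].
HB.instance Definition _ := [SubChoice_isSubComNzRing of rees by <:].

(* The kernel of the surjection from the Rees algebra, the sum of the I^k t^k,
   onto the sum of the I^k / m I^k. *)
Definition fiber_ideal : {pred rees} :=
  fun p => `[< forall k, (val p)`_k \in ideal_mul maxideal (ideal_pow I k) >].

Lemma fiber_ideal_closed : idealr_closed fiber_ideal.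
Proof.
split=> [||p u v /asboolP Iu /asboolP Iv].
- by apply/asboolP => k; rewrite raddf0 coef0 ideal0.
- apply/asboolP => /(_ 0); rewrite rmorph1 coef1 /= mulr1n => /asboolP[s sP e1].
  move/negP: maxideal_proper; apply; rewrite e1 big_seq.
  apply: ideal_sum => -[c d] /(allP sP) /= /andP[Ic _].
  by rewrite mulrC; exact: (idealMl (I := maxideal)).
apply/asboolP => k; have -> : val (p * u + v) = val p * val u + val v by [].
rewrite coefD idealD //.
rewrite coefM; apply: ideal_sum => i _.
have /asboolP[s sP ->] := Iu (k - i)%N.
rewrite mulr_sumr big_seq; apply: ideal_sum => -[c d] /(allP sP) /= /andP[Ic Id].
rewrite mulrCA; apply: ideal_mulMl => //.
have /asboolP/(_ i) Ip := rees_valP p.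
by have := ideal_powM Ip Id; rewrite subnKC // -ltnS.
Qed.

HB.instance Definition _ := isIdealr.Build rees fiber_ideal fiber_ideal_closed.

Definition fiber_cone : comNzRingType := {ideal_quot fiber_ideal}.

Definition is_analytic_spread (l : nat) : Prop := is_krull_dim fiber_cone l.

Definition monomials (s : seq 'X_{1..n}) : seq S := [seq 'X_[a] | a <- s].

Definition minimal_monomial_gens (s : seq 'X_{1..n}) : Prop :=
  I =i ideal_gen (monomials s) /\
  (forall a, a \in s -> ~ (I =i ideal_gen (monomials (rem a s)))).

Definition equigenerated_monomial : Prop :=
  exists d, exists2 s, minimal_monomial_gens s & all (fun a => mdeg a == d) s.

(* The defining equation is stated over int, as subtraction on nat truncates. *)
Definition Freiman : Prop :=
  equigenerated_monomial /\
  exists l r r2 : nat,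
    [/\ is_analytic_spread l, is_mu I r, is_mu (ideal_pow I 2) r2
      & r2%:Z = l%:Z * r%:Z - 'C(l, 2)%:Z].

End FiberCone.

(* Main.v *)
Require Import Defs.
From HB Require Import structures.
From mathcomp Require Import all_boot all_algebra.
From mathcomp Require Import ring_quotient boolp mpoly zify.

(** Write M for the maximal ideal of S = K[x_1..x_n] and I for M^m.

    All the ideals involved are order ideals: I^k consists of the polynomials
    without terms of degree below mk ([order_ge_pow]).  By the argument of
    Nakayama's lemma, the ideal of the polynomials of order at least d needs as
    many generators as there are monomials of degree d
    ([order_ge_gen_size]), so mu(I) and mu(I^2) are the numbers of monomials of
    degree m and 2m.

    The analytic spread is n.  Sending an element of I^k / M I^k to its
    homogeneous part of degree mk embeds the fiber cone into S, with the m-th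
    Veronese subring as its image ([fiber_cone_embedding]).  The substitutions
    x_1 = ... = x_i = 0, for i = 0..n, have kernels that form a chain of n + 1
    primes.  Conversely, along a chain of primes P_0 < ... < P_e any choice of
    y_i in P_(i+1) outside P_i is algebraically independent over K
    ([chain_generic]), while n + 1 polynomials in n variables never are
    ([algebraic_dependence]).

    What remains is a count.  Call x_i large in a monomial of degree 2m if its
    exponent is at least m; a monomial has at most two large variables.  Counting
    pairs (monomial, large variable) gives n mu(I), and counting pairs (monomial,
    set of two large variables) gives the binomial coefficient n choose 2, whence
      mu(I^2) = n mu(I) - 'C(n, 2) + N,
    where N is the number of monomials of degree 2m whose exponents are all less
    than m ([size_mnms_double]).  Hence I is Freiman exactly when there is no
    such monomial, which for n >= 3 and m >= 2 fails unless n = 3 and m = 2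
    ([all_small_exists]): x_1^(m-1) x_2^(m-1) can be completed by x_3^2 if
    m >= 3, and by x_3 x_4 if n >= 4. *)

Set Implicit Arguments.
Unset Strict Implicit.
Unset Printing Implicit Defensive.

(** * Order ideals and their minimal numbers of generators *)

Section OrderIdeals.
Import GRing.Theory.
Local Open Scope ring_scope.

Lemma mem_ideal_gen (R : comNzRingType) (s : seq R) x : x \in s -> x \in ideal_gen s.
Proof.
move=> s_x; have lt_xs : (index x s < size s)%N by rewrite index_mem.
apply/asboolP; exists (fun j => (j == Ordinal lt_xs)%:R).
rewrite (bigD1 (Ordinal lt_xs)) //= big1 => [|j /negPf->]; last by rewrite mul0r.
by rewrite eqxx mul1r addr0 nth_index.
Qed.

Lemma ideal_gen_sub (R : comNzRingType) (s : seq R) (J : ideal R) :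
  {subset s <= J} -> {subset ideal_gen s <= J}.
Proof.
move=> sJ x /asboolP[c ->]; apply: ideal_sum => i _.
by apply/idealMl/sJ/mem_nth.
Qed.

Variables (K : fieldType) (n : nat).
Local Notation S := {mpoly K[n]}.
Local Notation mm := (maxideal K n).

Definition order_ge_mem d : {pred S} :=
  fun p => all (fun a => d <= mdeg a)%N (msupp p).

Lemma order_ge_memP d (p : S) :
  reflect (forall a, (mdeg a < d)%N -> p@_a = 0) (p \in order_ge_mem d).
Proof.
apply: (iffP allP) => [Op a lt_ad|Op a].
  by apply/memN_msupp_eq0; apply: contraL lt_ad => /Op; rewrite -leqNgt.
by rewrite mcoeff_msupp leqNgt; apply: contra => /Op ->.
Qed.

Lemma order_ge_memM i j p q :
  p \in order_ge_mem i -> q \in order_ge_mem j -> p * q \in order_ge_mem (i + j).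
Proof.
move=> /order_ge_memP Op /order_ge_memP Oq; apply/order_ge_memP => a ad.
rewrite mcoeffM big1 // => -[b c] /= /eqP def_a.
have [lt_bi|le_ib] := ltnP (mdeg b) i; first by rewrite Op ?mul0r.
by rewrite [q@_c]Oq ?mulr0 //; move: ad (congr1 mdeg def_a); rewrite mdegD; lia.
Qed.

Lemma order_ge_closed d : ideal_closed (order_ge_mem d).
Proof.
split=> [|p q r Oq /order_ge_memP Or].
  by apply/order_ge_memP => a _; rewrite mcoeff0.
have Op : p \in order_ge_mem 0 by apply/order_ge_memP.
have /order_ge_memP Opq := order_ge_memM Op Oq.
by apply/order_ge_memP => a lt_ad; rewrite mcoeffD Opq ?Or ?addr0.
Qed.
Definition order_ge d := Ideal (order_ge_closed d).

Lemma order_geP d (p : S) :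
  reflect (forall a, (mdeg a < d)%N -> p@_a = 0) (p \in order_ge d).
Proof. exact: order_ge_memP. Qed.

Lemma order_geM i j p q :
  p \in order_ge i -> q \in order_ge j -> p * q \in order_ge (i + j).
Proof. exact: order_ge_memM. Qed.

Lemma order_geX d a : ('X_[a] \in order_ge d) = (d <= mdeg a)%N.
Proof. by rewrite -[LHS]/(all _ _) msuppX /= andbT. Qed.

(** This makes the order ideals multiplicative: a monomial of degree at least
    i + j splits off a factor of degree exactly i. *)
Lemma lem_mdeg_between i (a : 'X_{1..n}) :
  (i <= mdeg a)%N -> exists2 b, (b <= a)%MM & mdeg b = i.
Proof.
elim: i => [_|i IHi lt_ia].
  by exists 0%MM; rewrite ?mdeg0 //; apply/mnm_lepP=> j; rewrite mnm0E.
have [b le_ba deg_b] := IHi (ltnW lt_ia).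
have [j lt_j] : exists j, (b j < a j)%N.
  apply/existsP; apply: contraTT lt_ia; rewrite negb_exists => /forallP le_ab.
  by rewrite -leqNgt -deg_b !mdegE leq_sum // => j _; rewrite leqNgt.
exists (b + U_(j))%MM; last by rewrite mdegD mdeg1 deg_b addn1.
apply/mnm_lepP => k; rewrite mnmDE mnm1E; case: eqP => [<-|_]; first by rewrite addn1.
by rewrite addn0; apply/mnm_lepP.
Qed.

Lemma order_ge_mul (I J : ideal S) i j :
  I =i order_ge i -> J =i order_ge j -> ideal_mul I J =i order_ge (i + j).
Proof.
move=> OI OJ p; apply/idP/idP.
  move=> /asboolP[s /allP sIJ ->]; rewrite big_seq; apply: ideal_sum.
  by move=> ab /sIJ/andP[]; rewrite OI OJ; apply: order_geM.
move=> /allP Op; rewrite [p]mpolyE big_seq; apply: ideal_sum => a /Op le_ija.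
have [|b le_ba deg_b] := @lem_mdeg_between i a; first by lia.
rewrite -mul_mpolyC -(submK le_ba) mpolyXD; apply: idealMl.
rewrite mulrC; apply: ideal_mulMl; rewrite ?OI ?OJ order_geX ?deg_b //.
have := congr1 mdeg (submK le_ba); rewrite mdegD deg_b; lia.
Qed.

Lemma order_ge_full : ideal_full S =i order_ge 0.
Proof. by move=> p; apply/esym/order_geP. Qed.

Lemma order_ge_maxideal : mm =i order_ge 1.
Proof.
have Xmm (i : 'I_n) : 'X_i \in mm by apply/mem_ideal_gen/map_f; rewrite mem_enum.
move=> p; apply/idP/idP.
  by apply: ideal_gen_sub => _ /mapP[j _ ->]; rewrite order_geX mdeg1.
move=> /allP Op; rewrite [p]mpolyE big_seq; apply: ideal_sum => a /Op.
rewrite lt0n mdeg_eq0 => a0.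
have [i ai] : exists i, a i != 0%N.
  apply/existsP; apply: contraNT a0; rewrite negb_exists => /forallP a0.
  by apply/eqP/mnmP => i; rewrite mnm0E; apply/eqP; rewrite -[_ == _]negbK.
by rewrite -mul_mpolyC -(submK (m := U_(i)) (m' := a)) ?lep1mP // mpolyXD mulrA idealMl.
Qed.

Lemma order_ge_pow (I : ideal S) d k :
  I =i order_ge d -> ideal_pow I k =i order_ge (d * k).
Proof.
move=> OI; elim: k => [|k IHk]; first by rewrite muln0; exact: order_ge_full.
by rewrite mulnS; exact: order_ge_mul.
Qed.

Lemma order_ge_maxpow d : ideal_pow mm d =i order_ge d.
Proof.
by rewrite -[d in order_ge d]mul1n; apply: order_ge_pow; exact: order_ge_maxideal.
Qed.

(** Filtering the monomials of degree at most d gives a duplicate-free list. *)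
Definition mnms d : seq 'X_{1..n} :=
  [seq a <- [seq bmnm b | b : 'X_{1..n < d.+1}] | mdeg a == d].

Lemma mem_mnms d a : (a \in mnms d) = (mdeg a == d).
Proof.
rewrite mem_filter andb_idr // => /eqP deg_a.
have lt_ad : (mdeg a < d.+1)%N by rewrite deg_a.
by apply/mapP; exists (BMultinom lt_ad); rewrite ?mem_enum.
Qed.

Lemma mnms_uniq d : uniq (mnms d).
Proof. by rewrite filter_uniq // map_inj_uniq ?enum_uniq //; exact: val_inj. Qed.

Lemma order_ge_gen d : ideal_gen (monomials K (mnms d)) =i order_ge d.
Proof.
move=> p; apply/idP/idP.
  apply: ideal_gen_sub => _ /mapP[a + ->].
  by rewrite mem_mnms order_geX => /eqP ->.
move=> /allP Op; rewrite [p]mpolyE big_seq; apply: ideal_sum => a /Op le_da.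
have [b le_ba /eqP] := lem_mdeg_between le_da; rewrite -mem_mnms => deg_b.
rewrite -mul_mpolyC -(submK le_ba) mpolyXD mulrA idealMl //.
by apply: mem_ideal_gen; apply: map_f.
Qed.

(** The argument of Nakayama's lemma: modulo polynomials of order above d, the
    multiplier of a generator only acts through its constant term, so s spans a
    K-vector space that has the monomials of degree d as a basis. *)
Lemma order_ge_gen_size d (s : seq S) :
  order_ge d =i ideal_gen s -> (size (mnms d) <= size s)%N.
Proof.
move=> Os; pose r := size (mnms d).
have sO i : (i < size s)%N -> s`_i \in order_ge d.
  by move=> lt_is; rewrite Os mem_ideal_gen ?mem_nth.
have gen_mon (i : 'I_r) :
    exists c : 'I_(size s) -> S, 'X_[(nth 0%MM (mnms d) i)] = \sum_j c j * s`_j.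
  apply/asboolP; rewrite -[X in is_true X]/(_ \in ideal_gen s) -Os order_geX.
  by have := mem_nth 0%MM (ltn_ord i); rewrite mem_mnms => /eqP ->.
have [c c_gen] := choice gen_mon.
pose B := \matrix_(j < size s, k < r) (s`_j)@_(nth 0%MM (mnms d) k).
pose C := \matrix_(i < r, j < size s) (c i j)@_0%MM.
(* B holds the degree d parts of s, C the constant terms of the multipliers. *)
suff CB1 : C *m B = 1%:M.
  by rewrite -/r -(mxrank1 K r) -CB1 (leq_trans (mxrankM_maxr _ _)) ?rank_leq_row.
apply/matrixP => i k; rewrite !mxE.
have <- : ('X_[(nth 0%MM (mnms d) i)] : S)@_(nth 0%MM (mnms d) k) = (i == k)%:R.
  by rewrite mcoeffX nth_uniq ?mnms_uniq.
rewrite c_gen raddf_sum; apply: eq_bigr => j _; rewrite !mxE /=.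
set a := nth 0%MM (mnms d) k.
have deg_a : mdeg a = d by apply/eqP; rewrite -mem_mnms mem_nth.
(* s`_j has no term of degree below d = mdeg a, so that only the product of the
   constant term of c i j with the coefficient of s`_j at a contributes. *)
have /order_geP Os_j := sO j (ltn_ord j).
have lt0 : (mdeg (0%MM : 'X_{1..n}) < (mdeg a).+1)%N by rewrite mdeg0.
have lta : (mdeg a < (mdeg a).+1)%N by [].
rewrite mcoeffM (bigD1 (BMultinom lt0, BMultinom lta)) /=; last by rewrite add0m.
rewrite big1 ?addr0 // => -[b e] /= /andP[/eqP def_a].
have [lt_ed _|le_de] := ltnP (mdeg e) d; first by rewrite (Os_j e) ?mulr0.
have b0 : bmnm b = 0%MM.
  by apply/eqP; rewrite -mdeg_eq0; move: (congr1 mdeg def_a); rewrite mdegD; lia.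
have ea : bmnm e = a by apply: etrans (esym def_a); rewrite b0 add0m.
by case/negP; rewrite xpair_eqE !bmeqP /= b0 ea !eqxx.
Qed.

Lemma is_mu_order_ge (I : ideal S) d : I =i order_ge d -> is_mu I (size (mnms d)).
Proof.
move=> OI; split; last by move=> s Is; apply: order_ge_gen_size => p; rewrite -OI.
by exists (monomials K (mnms d)); rewrite ?size_map // => p; rewrite order_ge_gen.
Qed.

Lemma equigenerated_order_ge (I : ideal S) d :
  I =i order_ge d -> equigenerated_monomial I.
Proof.
move=> OI; exists d, (mnms d); last by apply/allP => a; rewrite mem_mnms.
split=> [p|a a_in I_gen]; first by rewrite order_ge_gen.
have := order_ge_gen_size (fun p => etrans (esym (OI p)) (I_gen p)).
by rewrite size_map size_rem //; case: (mnms d) a_in => //= b s _; rewrite ltnn.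
Qed.

Lemma is_mu_uniq (R : comNzRingType) (I : ideal R) r r' :
  is_mu I r -> is_mu I r' -> r = r'.
Proof.
move=> [[s Is <-] min] [[s' Is' <-] min']; apply/eqP.
by rewrite eqn_leq min ?min'.
Qed.

End OrderIdeals.

(** * Counting monomials of degree 2m by their large exponents *)

Section Counting.

Variable n : nat.
Implicit Types (a b : 'X_{1..n}).

(** Multiplication by b is a bijection onto the multiples of b. *)
Lemma size_mnms_ge d b :
  size [seq a <- mnms n (d + mdeg b) | (b <= a)%MM] = size (mnms n d).
Proof.
rewrite -[RHS](size_map (fun a => (a + b)%MM)); apply/perm_size/uniq_perm.
- by rewrite filter_uniq // mnms_uniq.
- by rewrite map_inj_uniq ?mnms_uniq //; exact: addIm.
move=> a; rewrite mem_filter mem_mnms; apply/andP/mapP => [[le_ba deg_a]|[c + ->]].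
  exists (a - b)%MM; last by rewrite submK.
  by rewrite mem_mnms -(eqn_add2r (mdeg b)) -mdegD submK.
by rewrite mem_mnms => /eqP <-; rewrite mdegD eqxx lem_addl.
Qed.

Definition large m a : {set 'I_n} := [set i | m <= a i].

(** Both sides count the pairs of a monomial and a set A of j of its large
    variables: for a given A, the monomials are the multiples of the product of
    the x_i^m with i in A. *)
Lemma sum_binomial_large m d j :
  \sum_(a <- mnms n (d + j * m)) 'C(#|large m a|, j) = 'C(n, j) * size (mnms n d).
Proof.
transitivity (\sum_(a <- mnms n (d + j * m))
                \sum_(A : {set 'I_n} | #|A| == j) (A \subset large m a)).
  apply: eq_bigr => a _; rewrite -cards_draws -sum1_card -big_mkcondr /=.
  by apply: eq_bigl => A; rewrite inE andbC.
have -> : 'C(n, j) = #|[set A : {set 'I_n} | #|A| == j]| by rewrite card_draws card_ord.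
rewrite exchange_big /= -sum_nat_const.
rewrite [RHS](eq_bigl (fun A : {set 'I_n} => #|A| == j)) => [|A]; last by rewrite inE.
apply: eq_bigr => A /eqP <-.
(* The exponent vector of the product of the x_i^m with i in A. *)
pose b := [multinom (i \in A) * m | i < n].
have -> : #|A| * m = mdeg b.
  rewrite mdegE -sum1_card big_distrl /= big_mkcond; apply: eq_bigr => i _.
  by rewrite mnmE; case: ifP.
rewrite -(size_mnms_ge d b) -sum1_size big_filter -big_mkcond /=; apply: eq_bigl => a.
apply/subsetP/mnm_lepP => [sAa i|le_ba i Ai].
  by rewrite mnmE; case: (boolP (i \in A)) => [/sAa|//]; rewrite inE mul1n.
by rewrite inE; have := le_ba i; rewrite mnmE Ai mul1n.
Qed.

Lemma card_large_le m a k : 0 < m -> mdeg a <= k * m -> #|large m a| <= k.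
Proof.
move=> m0 le_am; rewrite -(leq_pmul2r m0); apply: leq_trans le_am.
rewrite mdegE -sum1_card big_distrl /= big_mkcond; apply: leq_sum => i _.
by rewrite inE; case: ifP; rewrite ?mul1n.
Qed.

(** Since k = #|large m a| is at most 2, summing 1 + 'C(k, 2) = k + (k == 0) over
    the monomials of degree 2m gives the identity. *)
Lemma size_mnms_double m : 0 < m ->
  size (mnms n (2 * m)) + 'C(n, 2) =
  n * size (mnms n m) + count (fun a => large m a == set0) (mnms n (2 * m)).
Proof.
move=> m0.
have eC2 : \sum_(a <- mnms n (2 * m)) 'C(#|large m a|, 2) = 'C(n, 2).
  have := sum_binomial_large m 0 2; rewrite add0n => ->.
  suff -> : mnms n 0 = [:: 0%MM] by rewrite muln1.
  apply: perm_small_eq => //; apply: uniq_perm; rewrite ?mnms_uniq // => a.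
  by rewrite mem_mnms mdeg_eq0 inE.
have eC1 : \sum_(a <- mnms n (2 * m)) 'C(#|large m a|, 1) = n * size (mnms n m).
  by have := sum_binomial_large m m 1; rewrite mul1n addnn -mul2n bin1.
rewrite -eC1 -eC2 -sum1_size -sum1_count [X in _ = _ + X]big_mkcond -!big_split /=.
rewrite big_seq [RHS]big_seq; apply: eq_bigr => a; rewrite mem_mnms => /eqP deg_a.
have := @card_large_le m a 2 m0; rewrite deg_a => /(_ (leqnn _)).
by rewrite -cards_eq0; case: #|_| => [|[|[|]]].
Qed.

(** If all exponents are less than m, then 2m <= n (m - 1); the converse needs
    only a monomial supported on three or four variables. *)
Lemma all_small_exists m : 0 < m ->
  (exists2 a : 'X_{1..n}, mdeg a = 2 * m & forall i, a i < m) <->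
  ~ (m = 1 \/ n <= 2 \/ n = 3 /\ m = 2).
Proof.
move=> m0; split=> [[a deg_a lt_am]|not_small].
  have : 2 * m <= n * m.-1.
    rewrite -deg_a mdegE -[n in n * _]card_ord -sum_nat_const.
    by apply: leq_sum => i _; move: (lt_am i); lia.
  have : m.-1 < m by rewrite prednK.
  by move=> _ le [m1|[n2|[n3 m2]]]; nia.
have [m2 [n3 nm]] : 1 < m /\ 2 < n /\ (n = 3 -> 2 < m) by lia.
pose s := if n == 3 then [:: m.-1; m.-1; 2] else [:: m.-1; m.-1; 1; 1].
exists [multinom nth 0 s i | i < n]; last first.
  move=> i; rewrite mnmE /s; case: ifP => [/eqP n_eq|_]; last first.
    by case: (val i) => [|[|[|[|j]]]] /=; rewrite ?nth_nil; lia.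
  by have := nm n_eq; case: (val i) => [|[|[|[|j]]]] /= m3; rewrite ?nth_nil; lia.
rewrite mdegE (eq_bigr (fun i : 'I_n => nth 0 s i)) => [|i _]; last by rewrite mnmE.
have le_sn : size s <= n by rewrite /s; case: ifP => /eqP /=; lia.
rewrite -(big_mkord xpredT (nth 0 s)) (@big_cat_nat _ _ _ (size s)) //=.
rewrite [X in _ + X]big_nat_cond.
rewrite [X in _ + X]big1 => [|i /andP[/andP[le_si _] _]]; last by rewrite nth_default.
rewrite addn0 -(big_nth 0 xpredT id) -sumnE /s.
by case: ifP => [/eqP|] _ /=; lia.
Qed.

End Counting.

(** * Subalgebras of a polynomial ring in n variables have dimension at most n *)

Section Dimension.
Import GRing.Theory.
Local Open Scope ring_scope.

Lemma msizeM_leS (R : idomainType) n (p q : {mpoly R[n]}) s t :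
  (msize p <= s.+1 -> msize q <= t.+1 -> msize (p * q) <= (s + t).+1)%N.
Proof.
have [->|p0] := eqVneq p 0; first by rewrite mul0r msize0.
have [->|q0] := eqVneq q 0; first by rewrite mulr0 msize0.
by rewrite msizeM //; lia.
Qed.

Lemma msize_mmap1 (R : idomainType) n k (y : 'I_k -> {mpoly R[n]}) (a : 'X_{1..k}) N D :
  (forall i, msize (y i) <= N)%N -> (forall i, a i <= D)%N ->
  (msize (mmap1 y a) <= (k * (D * N)).+1)%N.
Proof.
move=> yN aD; rewrite /mmap1 -[k in (k * _)%N]card_ord -sum_nat_const.
apply: (big_ind2 (fun p s => msize p <= s.+1)%N) => [|p s q t|i _].
  by rewrite msize1.
  exact: msizeM_leS.
apply: leq_trans (_ : _ <= (a i * N).+1)%N _; last by rewrite ltnS leq_mul2r aD orbT.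
elim: (a i) => [|e IHe]; first by rewrite expr0 msize1.
by rewrite exprS mulSn; apply: msizeM_leS => //; rewrite leqW.
Qed.

(** The D^(n+1) monomials in y whose exponents are less than D only involve
    monomials in x whose exponents are less than some M = O(D).  The latter
    span a space of dimension M^n, which is less than D^(n+1) for large D, so
    that the former are linearly dependent. *)
Lemma algebraic_dependence (K : fieldType) n (y : 'I_n.+1 -> {mpoly K[n]}) :
  exists2 Q : {mpoly K[n.+1]}, Q != 0 & mmap (@mpolyC n K) y Q = 0.
Proof.
pose N := \max_i msize (y i).
have yN i : (msize (y i) <= N)%N by exact: leq_bigmax.
(* With c * D >= M, it suffices that c^n < D. *)
pose c := (n.+1 * N).+1; pose D := (c ^ n).+1; pose M := (n.+1 * (D * N)).+1.
have lt_MD : (M ^ n < D ^ n.+1)%N.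
  have le_McD : (M <= c * D)%N by rewrite /M /c; nia.
  apply: (@leq_ltn_trans ((c * D) ^ n)%N).
    by case: (n) => // k; rewrite leq_exp2r.
  by rewrite expnMn expnS ltn_pmul2r ?expn_gt0.
pose mon k B (f : {ffun 'I_k -> 'I_B}) := [multinom (f i : nat) | i < k].
have mon_inj k B : injective (@mon k B).
  by move=> f g /mnmP fg; apply/ffunP => i; apply/val_inj; have := fg i; rewrite !mnmE.
pose A := \matrix_(r < #|{ffun 'I_n.+1 -> 'I_D}|, s < #|{ffun 'I_n -> 'I_M}|)
  (mmap1 y (mon _ _ (enum_val r)))@_(mon _ _ (enum_val s)).
have : kermx A != 0.
  rewrite kermx_eq0; apply: contraTneq (rank_leq_col A) => ->.
  by rewrite -ltnNge !card_ffun !card_ord.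
case/rowV0Pn => v /sub_kermxP vA v0.
pose Q : {mpoly K[n.+1]} := \sum_r v 0 r *: 'X_[mon _ _ (enum_val r)].
have [r0 vr0] : exists r, v 0 r != 0.
  apply/existsP; apply: contraNT v0; rewrite negb_exists => /forallP v0.
  by apply/eqP/rowP => r; rewrite mxE; apply/eqP; rewrite -[_ == _]negbK.
exists Q.
  apply: contraNneq vr0 => /(congr1 (mcoeff (mon _ _ (enum_val r0)))).
  rewrite mcoeff0 raddf_sum (bigD1 r0) //= mcoeffZ mcoeffX eqxx mulr1.
  rewrite big1 ?addr0 => [->//|r ne_r]; rewrite mcoeffZ mcoeffX.
  by rewrite (inj_eq (@mon_inj _ _)) (inj_eq enum_val_inj) (negPf ne_r) mulr0.
have -> : mmap (@mpolyC n K) y Q = \sum_r v 0 r *: mmap1 y (mon _ _ (enum_val r)).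
  by rewrite /Q raddf_sum; apply: eq_bigr => r _; rewrite /= mmapZ mmapX mul_mpolyC.
apply/mpolyP => a; rewrite mcoeff0 raddf_sum /=.
have [small_a|] := boolP [forall i, a i < M]%N.
  pose f : {ffun 'I_n -> 'I_M} := [ffun i => Ordinal (forallP small_a i)].
  have -> : a = mon _ _ (enum_val (enum_rank f)).
    by apply/mnmP => i; rewrite enum_rankK mnmE ffunE.
  have /matrixP/(_ 0 (enum_rank f)) := vA; rewrite !mxE => vA_f.
  by apply: etrans vA_f; apply: eq_bigr => r _; rewrite mcoeffZ !mxE.
(* Here a has too large a degree to occur in any of the monomials in y. *)
rewrite negb_forall => /existsP[i]; rewrite -leqNgt => le_Ma.
rewrite big1 // => r _; rewrite mcoeffZ memN_msupp_eq0 ?mulr0 //.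
apply/msize_mdeg_ge/leq_trans/(leq_trans le_Ma).
  by apply: msize_mmap1 => // j; rewrite mnmE ltnW.
by rewrite mdegE (bigD1 i) //= leq_addr.
Qed.

Section Chains.
Variables (R : comNzRingType) (d : nat) (P : nat -> {pred R}) (y : 'I_d -> R).
Hypotheses (chainP : prime_chain d P) (y_in : forall i : 'I_d, y i \in P i.+1).
Hypothesis (y_notin : forall i : 'I_d, y i \notin P i).

(** Look at the lexicographically smallest exponent b of Q.  Suppose that Q(y)
    lies in P_0.  As y_0 is not in the prime P_0, the largest power of y_0
    dividing all terms can be cancelled; as y_0 lies in P_1, the terms that
    still contain y_0 can be dropped modulo P_1.  Repeating this with y_1, y_2
    and so on leaves the nonzero constant Q@_b in the last prime. *)
Lemma chain_generic (K : fieldType) (kappa : {rmorphism K -> R}) (Q : {mpoly K[d]}) :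
  Q != 0 -> mmap kappa y Q \notin P 0%N.
Proof.
move=> Q0; apply/negP => QP0.
(* F k b is what is left after k steps: among the terms of Q that agree with b
   at the variables below k, only the factors y_i with k <= i are kept. *)
pose agree k (a b : 'X_{1..d}) := [forall (j : 'I_d | (j < k)%N), a j == b j].
pose F k b := \sum_(a <- msupp Q | agree k a b)
  kappa Q@_a * \prod_(i < d | (k <= i)%N) y i ^+ a i.
have [primeP incP] := chainP.
suff /(_ d (leqnn d))[b supp_b] :
    forall k, (k <= d)%N -> exists2 b, b \in msupp Q & F k b \in P k.
  have -> : F d b = kappa Q@_b.
    rewrite /F -big_filter (_ : filter _ _ = [:: b]) ?big_seq1.
      by rewrite big_pred0 ?mulr1 // => i; rewrite leqNgt ltn_ord.
    apply: perm_small_eq => //; apply: uniq_perm => // [|a].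
      by rewrite filter_uniq ?msupp_uniq.
    rewrite mem_filter inE; apply/andP/eqP => [[/forall_inP ab _]|->].
      by apply/mnmP => i; apply/eqP/ab.
    by split=> //; apply/forall_inP.
  move=> Pd; have [[P_0 /negP P1 Pl] _] := primeP d (leqnn d).
  apply: P1; rewrite -(rmorph1 kappa) -(@mulVf _ Q@_b) -?mcoeff_msupp // rmorphM.
  by rewrite -[_ * _]addr0; apply: Pl.
elim=> [_|k IHk lt_kd].
  (* No variable lies below 0: F 0 b is Q(y) for every b in the support. *)
  exists (mlead Q); rewrite ?mlead_supp //; move: QP0; rewrite /F.
  congr (_ \in P 0%N); apply: eq_big => // a.
  by symmetry; apply/forall_inP.
have [b supp_b FP] := IHk (ltnW lt_kd); pose j := Ordinal lt_kd.
(* The next exponent is chosen to have the least degree in y j. *)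
have [b' supp_b' /andP[agree_b' min_b']] : exists2 b', b' \in msupp Q &
    agree k b' b && all (fun a => agree k a b ==> (b' j <= a j)%N) (msupp Q).
  have : exists e, has (fun a => agree k a b && (a j == e)) (msupp Q).
    by exists (b j); apply/hasP; exists b; rewrite ?eqxx ?andbT //; apply/forall_inP.
  case/ex_minnP => e /hasP[a supp_a /andP[agree_a /eqP aj]] min_e.
  exists a => //; rewrite agree_a; apply/allP => a' supp_a'; apply/implyP => agree_a'.
  by rewrite aj; apply: min_e; apply/hasP; exists a'; rewrite ?agree_a' /=.
exists b' => //.
have agreeS a : agree k.+1 a b' = agree k a b && (a j == b' j).
  apply/forall_inP/andP => [ab'|[/forall_inP ab /eqP aj] i].
    split; last exact: ab'.
    apply/forall_inP => i lt_ik; rewrite (eqP (ab' i _)) ?ltnS 1?ltnW //.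
    exact: (forall_inP agree_b').
  rewrite ltnS leq_eqVlt => /orP[/eqP ij|lt_ik].
    by have -> : i = j by [apply: val_inj]; rewrite aj.
  by rewrite (eqP (ab i lt_ik)) eq_sym; exact: (forall_inP agree_b').
pose G := \sum_(a <- msupp Q | agree k a b && (a j != b' j))
  kappa Q@_a * (y j ^+ (a j - b' j).-1 * \prod_(i < d | (k < i)%N) y i ^+ a i).
have F_split : F k b = y j ^+ b' j * (F k.+1 b' + y j * G).
  have prodS a : \prod_(i < d | (k <= i)%N) y i ^+ a i =
      y j ^+ a j * \prod_(i < d | (k < i)%N) y i ^+ a i.
    rewrite (bigD1 j) //=; congr (_ * _); apply: eq_bigl => i.
    by rewrite ltn_neqAle andbC eq_sym.
  rewrite /F (bigID (fun a : 'X_{1..d} => a j == b' j)) /= mulrDr; congr (_ + _).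
    rewrite mulr_sumr; apply: eq_big => a; first by rewrite agreeS.
    by case/andP=> _ /eqP aj; rewrite prodS aj mulrCA.
  rewrite /G !mulr_sumr big_seq_cond [RHS]big_seq_cond; apply: eq_bigr => a.
  case/andP=> supp_a /andP[agree_a ne_a].
  have lt_a : (b' j < a j)%N.
    by rewrite ltn_neqAle eq_sym ne_a (implyP (allP min_b' a supp_a)).
  set e := (a j - b' j).-1; have aj : a j = (b' j + e.+1)%N by rewrite /e; lia.
  by rewrite prodS aj exprD exprS -!mulrA mulrCA; congr (_ * _); rewrite mulrCA.
have [[P0 P1 Pl] prime_k] := primeP k (ltnW lt_kd).
have [[P0' _ Pl'] _] := primeP k.+1 lt_kd.
have [subP _] := incP k lt_kd.
have y_exp e : y j ^+ e \notin P k.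
  elim: e => [|e IHe]; first by rewrite expr0.
  by rewrite exprS; apply/negP => /prime_k; rewrite (negPf IHe) (negPf (y_notin j)).
move: FP; rewrite F_split => /prime_k; rewrite (negPf (y_exp _)) /= => /subP sumP.
have := Pl' (- G) (y j) (F k.+1 b' + y j * G) (y_in j) sumP.
by rewrite mulNr [y j * G]mulrC addrCA addNr addr0.
Qed.
End Chains.

(** If e > n, the first n + 1 steps of the chain provide n + 1 elements of R that
    are algebraically independent, against the dependence of their images. *)
Lemma prime_chain_le (K : fieldType) n (R : comNzRingType) (kappa : {rmorphism K -> R})
    (psi : {rmorphism R -> {mpoly K[n]}}) e P :
  injective psi -> (forall c, psi (kappa c) = c%:MP) ->
  @prime_chain R e P -> (e <= n)%N.
Proof.
move=> psi_inj psi_kappa [primeP incP]; rewrite leqNgt; apply/negP => lt_ne.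
have chainP : prime_chain n.+1 P.
  by split=> i le_in; [apply: primeP|apply: incP]; exact: leq_trans lt_ne.
have /choice[y yP] (i : 'I_n.+1) : exists z, z \in P i.+1 /\ z \notin P i.
  have [subP neP] := incP i (leq_trans (ltn_ord i) lt_ne).
  apply: contrapT => noz; apply: neP => x; apply/idP/idP => [/subP //|Px].
  by apply: contrapT => /negP nPx; apply: noz; exists x.
have [Q Q0 Qpsi] := algebraic_dependence (psi \o y).
have /negP[] := chain_generic chainP (fun i => (yP i).1) (fun i => (yP i).2) kappa Q0.
suff -> : mmap kappa y Q = 0 by have [[]] := primeP 0%N isT.
apply: psi_inj; rewrite rmorph0 -Qpsi /mmap rmorph_sum; apply: eq_bigr => a _.
rewrite rmorphM /= psi_kappa rmorph_prod; congr (_ * _).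
by apply: eq_bigr => i _; rewrite rmorphXn.
Qed.

End Dimension.

(** * The fiber cone of an order ideal *)

Section FiberConeDim.
Import GRing.Theory.
Local Open Scope ring_scope.
Local Open Scope quotient_scope.

Variables (K : fieldType) (n : nat).
Local Notation S := {mpoly K[n]}.
Local Notation hpart := (pihomog (@mdeg n)).

Lemma mcoeff_pihomog d (p : S) a : (hpart d p)@_a = if mdeg a == d then p@_a else 0.
Proof.
rewrite pihomogE [in RHS](mpolyE p) !raddf_sum /=.
case: ifP => [/eqP <-|ne_ad].
  rewrite big_mkcond; apply: eq_bigr => b _; case: ifP => //.
  by rewrite !mcoeffZ mcoeffX; case: (b =P a) => [->|_]; rewrite ?eqxx ?mulr0.
rewrite big1 // => b /eqP deg_b; rewrite mcoeffZ mcoeffX.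
by case: (b =P a) ne_ad => [<-|_ _]; rewrite ?mulr0 // deg_b eqxx.
Qed.

Lemma pihomog_eq0 d (p : S) :
  p \in order_ge K n d -> (hpart d p == 0) = (p \in order_ge K n d.+1).
Proof.
move=> /order_geP Op; apply/eqP/order_geP => [pi0 a|Op']; last first.
  apply/mpolyP => a; rewrite mcoeff_pihomog mcoeff0.
  by case: eqP => // deg_a; rewrite Op' ?deg_a.
rewrite ltnS leq_eqVlt => /orP[deg_a|/Op //].
by have := congr1 (mcoeff a) pi0; rewrite mcoeff_pihomog deg_a mcoeff0.
Qed.

(** The remainders p - hpart i p and q - hpart j q have order above i and j, so
    that they only contribute terms of degree above i + j to the product. *)
Lemma pihomogM i j (p q : S) : p \in order_ge K n i -> q \in order_ge K n j ->
  hpart (i + j) (p * q) = hpart i p * hpart j q.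
Proof.
have pi_order d (r : S) : r \in order_ge K n d ->
    hpart d r \in order_ge K n d /\ r - hpart d r \in order_ge K n d.+1.
  move=> /order_geP Or; split; apply/order_geP => a lt_ad.
    by rewrite mcoeff_pihomog; case: eqP lt_ad => [->|//]; rewrite ltnn.
  rewrite mcoeffB mcoeff_pihomog; case: eqP => [_|ne_ad]; first by rewrite subrr.
  by rewrite Or ?subr0 //; lia.
move=> Op Oq; have [Op1 Op2] := pi_order i p Op; have [Oq1 Oq2] := pi_order j q Oq.
rewrite -[RHS](@pihomog_dE _ _ mdeg (i + j)); last by apply: dhomogM; exact: pihomogP.
apply/eqP; rewrite -subr_eq0 -raddfB.
have -> : p * q - hpart i p * hpart j q =
          (p - hpart i p) * q + hpart i p * (q - hpart j q).
  by rewrite mulrBl mulrBr addrA subrK.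
rewrite /= pihomog_eq0.
  apply: idealD; first by rewrite -addSn; apply: order_geM.
  by rewrite -addnS; apply: order_geM.
have lt_ge d r : r \in order_ge K n d.+1 -> r \in order_ge K n d.
  by move=> /order_geP Or; apply/order_geP => a lt_ad; rewrite Or // ltnW.
by apply: idealD; apply: order_geM => //; exact: lt_ge.
Qed.

Section Initial.
Variable m : nat.
Hypothesis m_gt0 : (0 < m)%N.

(** A first step that keeps the grading by powers of the Rees variable: at this
    level multiplicativity can be checked one coefficient at a time. *)
Definition initial_poly (p : {poly S}) : {poly S} :=
  \poly_(k < size p) hpart (m * k) p`_k.

Lemma coef_initial_poly p k : (initial_poly p)`_k = hpart (m * k) p`_k.
Proof.
by rewrite coef_poly; case: ltnP => // le_pk; rewrite nth_default // raddf0.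
Qed.

(** Putting the Rees variable equal to 1 loses nothing, as the k-th coefficient
    can be read off from the part of degree mk. *)
Definition initial p : S := (initial_poly p).[1].

Lemma initial_is_zmod_morphism : zmod_morphism initial.
Proof.
move=> p q; rewrite /initial -hornerN -hornerD; congr (_.[1]).
by apply/polyP => k; rewrite coefB !coef_initial_poly coefB raddfB.
Qed.

Lemma mcoeff_initial p k a : mdeg a = (m * k)%N -> (initial p)@_a = p`_k@_a.
Proof.
move=> deg_a; rewrite /initial horner_coef raddf_sum /=.
have -> : p`_k@_a = ((initial_poly p)`_k)@_a.
  by rewrite coef_initial_poly mcoeff_pihomog deg_a eqxx.
have coef_a j : j != k -> ((initial_poly p)`_j)@_a = 0.
  move=> ne_jk; rewrite coef_initial_poly mcoeff_pihomog deg_a; case: eqP => // /eqP.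
  by rewrite eqn_pmul2l // eq_sym (negPf ne_jk).
have [lt_k|le_k] := ltnP k (size (initial_poly p)).
  rewrite (bigD1 (Ordinal lt_k)) //= big1 => [|j ne_jk].
    by rewrite expr1n mulr1 addr0.
  by rewrite expr1n mulr1 coef_a.
rewrite [X in _ = X@__]nth_default // mcoeff0 big1 // => j _.
by rewrite expr1n mulr1 coef_a // neq_ltn (leq_trans (ltn_ord j)).
Qed.

Variable I : ideal S.
Hypothesis OI : I =i order_ge K n m.

Lemma rees_order (p : rees I) k : (val p)`_k \in order_ge K n (m * k).
Proof. by have /asboolP/(_ k) := rees_valP p; rewrite (order_ge_pow _ OI). Qed.

Lemma initialM (p q : rees I) :
  initial (val p * val q) = initial (val p) * initial (val q).
Proof.
rewrite /initial -hornerM; congr (_.[1]); apply/polyP => k.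
rewrite coefM coef_initial_poly coefM raddf_sum; apply: eq_bigr => i _.
rewrite !coef_initial_poly /= -{1}(subnKC (leq_ord i)) mulnDr.
by rewrite pihomogM ?rees_order.
Qed.

Lemma initial1 : initial 1 = 1.
Proof.
rewrite /initial (_ : initial_poly 1 = 1) ?hornerC //.
apply/polyP => k; rewrite coef_initial_poly coef1.
case: k => [|k] /=; last by rewrite raddf0.
by rewrite muln0 pihomog_dE ?dhomog1.
Qed.

(** I^k and M I^k consist of the polynomials of order at least mk and mk + 1, so
    for an element of I^k, being in M I^k means having no part of degree mk. *)
Lemma fiber_idealE (p : rees I) : (p \in @fiber_ideal K n I) = (initial (val p) == 0).
Proof.
have mm_pow k : ideal_mul (maxideal K n) (ideal_pow I k) =i order_ge K n (1 + m * k).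
  by apply: order_ge_mul; [exact: order_ge_maxideal|exact: order_ge_pow].
apply/asboolP/eqP => [fp|ini0 k].
  rewrite /initial (_ : initial_poly _ = 0) ?horner0 //.
  apply/polyP => k; rewrite coef_initial_poly coef0; apply/eqP.
  by rewrite pihomog_eq0 ?rees_order // -add1n -mm_pow.
rewrite mm_pow add1n -pihomog_eq0 ?rees_order //; apply/eqP/mpolyP => a.
rewrite mcoeff_pihomog mcoeff0; case: eqP => // deg_a.
by rewrite -(mcoeff_initial _ deg_a) ini0 mcoeff0.
Qed.

(** [initial] is a ring morphism on the Rees algebra with kernel [fiber_ideal]. *)
Lemma fiber_cone_embedding : exists2 psi : {rmorphism fiber_cone I -> S},
  injective psi & forall p : rees I, psi (\pi p) = initial (val p).
Proof.
pose psi0 (f : fiber_cone I) : S := initial (val (repr f : rees I)).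
have psi0_pi (p : rees I) : psi0 (\pi p) = initial (val p).
  apply/eqP; rewrite -subr_eq0 -initial_is_zmod_morphism.
  rewrite -[val _ - val _]/(val (repr (\pi_(fiber_cone I) p) - p)) -fiber_idealE.
  by rewrite Quotient.idealrBE reprK.
have psi0B : zmod_morphism psi0.
  move=> f g; rewrite -[f]reprK -[g]reprK -rmorphB !psi0_pi.
  by rewrite -initial_is_zmod_morphism.
have psi0M : monoid_morphism psi0.
  split=> [|f g].
    by rewrite -(rmorph1 \pi_(fiber_cone I)) psi0_pi; exact: initial1.
  by rewrite -[f]reprK -[g]reprK -rmorphM !psi0_pi; exact: initialM.
pose psi : {rmorphism fiber_cone I -> S} := HB.pack psi0
  (GRing.isZmodMorphism.Build _ _ psi0 psi0B)
  (GRing.isMonoidMorphism.Build _ _ psi0 psi0M).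
exists psi => // f g /eqP; rewrite -subr_eq0 -raddfB /= => psi_fg.
apply/eqP; rewrite -subr_eq0 -[_ - _]reprK -(rmorph0 \pi_(fiber_cone I)).
by rewrite -Quotient.idealrBE subr0 fiber_idealE.
Qed.

Lemma rees_monomial_proof (q : S) k : q \in order_ge K n (m * k) ->
  q%:P * 'X^k \in rees_mem I.
Proof.
move=> Oq; apply/asboolP => i; rewrite (order_ge_pow _ OI) coefCM coefXn.
by case: eqP => [->|_]; rewrite ?mulr1 // mulr0 ideal0.
Qed.

Lemma initial_monomial (q : S) k : q \is (m * k).-homog -> initial (q%:P * 'X^k) = q.
Proof.
move=> hom_q; rewrite /initial (_ : initial_poly _ = q%:P * 'X^k).
  by rewrite hornerCM hornerXn expr1n mulr1.
apply/polyP => i; rewrite coef_initial_poly coefCM coefXn.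
by case: eqP => [->|_]; rewrite ?mulr0 ?raddf0 // mulr1 pihomog_dE.
Qed.

(** Together with [fiber_cone_embedding]: the fiber cone is the Veronese ring. *)
Lemma fiber_cone_onto (psi : fiber_cone I -> S) q k :
  (forall p : rees I, psi (\pi p) = initial (val p)) ->
  q \is (m * k).-homog -> exists f, psi f = q.
Proof.
move=> psi_pi hom_q; have Oq : q \in order_ge K n (m * k).
  by apply/order_geP => a lt_a; rewrite (dhomog_nemf_coeff hom_q) // ltn_eqF.
exists (\pi_(fiber_cone I) (Rees (rees_monomial_proof Oq))).
by rewrite psi_pi initial_monomial.
Qed.

(** Substituting 0 for the first i variables; its kernel is (x_1, ..., x_i). *)
Definition kill i : n.-tuple S := [tuple if (j < i)%N then 0 else 'X_j | j < n].

Lemma tnth_kill i j : tnth (kill i) j = if (j < i)%N then 0 else 'X_j.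
Proof. by rewrite tnth_mktuple. Qed.

Lemma comp_kill i (p : S) : (p \mPo kill i) \mPo kill i.+1 = p \mPo kill i.+1.
Proof.
rewrite !(comp_mpolyE p) raddf_sum; apply: eq_bigr => a _.
rewrite /= comp_mpolyZ rmorph_prod; congr (_ *: _); apply: eq_bigr => j _.
rewrite rmorphXn /= !tnth_kill ltnS.
case: ltnP => [/ltnW ->|le_ij]; first by rewrite rmorph0.
by rewrite comp_mpolyXU -tnth_nth tnth_kill ltnS.
Qed.

(** The kernels of the substitutions [kill i] on the fiber cone are prime because
    S is a domain.  Their chain has length n, and [prime_chain_le] forbids longer
    ones. *)
Lemma fiber_cone_dim : is_krull_dim (fiber_cone I) n.
Proof.
have [psi psi_inj psi_pi] := fiber_cone_embedding.
split.
  pose P i : {pred fiber_cone I} := fun f => psi f \mPo kill i == 0.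
  have PE i f : (f \in P i) = (psi f \mPo kill i == 0) by [].
  exists P; split=> [i _|i lt_in].
    split=> [|f g]; last by rewrite !PE !rmorphM mulf_eq0.
    split=> [||f g h]; rewrite !PE ?rmorph0 //.
      by rewrite !rmorph1 oner_eq0.
    by rewrite !rmorphD !rmorphM /= => /eqP-> /eqP->; rewrite mulr0 addr0.
  split=> [f|P_eq].
    by rewrite !PE -(comp_kill i) => /eqP->; rewrite rmorph0.
  (* The m-th power of the variable killed at step i separates the two primes. *)
  pose j := Ordinal lt_in.
  have [f psi_f] : exists f, psi f = 'X_j ^+ m.
    apply: (fiber_cone_onto (k := 1)) psi_pi _; rewrite mulnC.
    by apply: dhomogMn; rewrite dhomogX /= mdeg1.
  have := P_eq f; rewrite !PE psi_f !rmorphXn /= !comp_mpolyXU -!tnth_nth !tnth_kill.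
  rewrite ltnn ltnS leqnn expr0n gtn_eqF // eqxx expf_eq0 m_gt0 /=.
  by move=> /eqP/(congr1 (fun p => msize p)); rewrite msizeX msize0.
move=> e P chainP.
have O0 (p : S) : p \in order_ge K n (m * 0) by rewrite muln0; apply/order_geP.
pose rees_const c : rees I := Rees (rees_monomial_proof (O0 c%:MP)).
pose kappa0 c : fiber_cone I := \pi_(fiber_cone I) (rees_const c).
have kappaB : zmod_morphism kappa0.
  move=> c d; rewrite /kappa0 -rmorphB; congr (\pi _); apply: val_inj.
  by rewrite /= !mulr1 !rmorphB.
have kappaM : monoid_morphism kappa0.
  split=> [|c d]; rewrite /kappa0.
    rewrite -(rmorph1 \pi_(fiber_cone I)); congr (\pi _); apply: val_inj.
    by rewrite /= !mulr1 !rmorph1.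
  rewrite -rmorphM; congr (\pi _); apply: val_inj.
  by rewrite /= !mulr1 !rmorphM.
pose kappa : {rmorphism K -> fiber_cone I} := HB.pack kappa0
  (GRing.isZmodMorphism.Build _ _ kappa0 kappaB)
  (GRing.isMonoidMorphism.Build _ _ kappa0 kappaM).
apply: (@prime_chain_le _ _ _ kappa psi _ P) => // c.
rewrite /= psi_pi initial_monomial // muln0 dhomogE; apply/allP => a.
by rewrite msuppC; case: ifP; rewrite ?inE // => _ /eqP->; rewrite /= mdeg0.
Qed.

End Initial.
End FiberConeDim.

(** * The Freiman property *)

Lemma krull_dim_uniq (R : comNzRingType) d e :
  is_krull_dim R d -> is_krull_dim R e -> d = e.
Proof.
move=> [[P chP] le_d] [[Q chQ] le_e]; apply/eqP.
by rewrite eqn_leq (le_e _ P) ?(le_d _ Q).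
Qed.

(** With l = n, the defining equation compares with [size_mnms_double] and says
    that there is no monomial of degree 2m with all exponents less than m. *)
Lemma Freiman_order_ge (K : fieldType) n (I : ideal {mpoly K[n]}) m : (0 < m)%N ->
  I =i order_ge K n m ->
  Freiman I <->
  ~ exists2 a : 'X_{1..n}, mdeg a = (2 * m)%N & forall i, (a i < m)%N.
Proof.
move=> m0 OI; have OI2 := order_ge_pow 2 OI.
have dimF := fiber_cone_dim m0 OI.
have muI := is_mu_order_ge OI; have muI2 := is_mu_order_ge OI2.
have := size_mnms_double n m0; rewrite [(2 * m)%N]mulnC.
set N0 := count _ _; set r := size (mnms n m) in muI *; set r2 := size _ in muI2 *.
move=> eq_r2.
have largeP (a : 'X_{1..n}) : (large m a == set0) = [forall i, (a i < m)%N].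
  apply/eqP/forallP => [/setP a0 i|lt_am].
    by have := a0 i; rewrite !inE ltnNge => ->.
  by apply/setP => i; rewrite !inE leqNgt lt_am.
have FN0 : Freiman I <-> N0 = 0%N.
  split=> [[_ [l [r' [r2' [dimF' muI' muI2' eqF]]]]]|N00].
    move: eqF; rewrite -(krull_dim_uniq dimF dimF').
    by rewrite -(is_mu_uniq muI muI') -(is_mu_uniq muI2 muI2'); lia.
  split; first exact: equigenerated_order_ge OI.
  by exists n, r, r2; split=> //; lia.
rewrite FN0; split=> [N00 [a deg_a lt_am]|noa].
  have : (0 < N0)%N.
    rewrite -has_count; apply/hasP; exists a; rewrite ?mem_mnms ?deg_a //.
    by rewrite largeP; apply/forallP.
  by rewrite N00.
apply/eqP; rewrite eqn0Ngt -has_count; apply/hasP => -[a].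
rewrite mem_mnms largeP => /eqP deg_a /forallP lt_am.
by apply: noa; exists a.
Qed.

Theorem theorem2p3 (K : fieldType) (n m : nat) (m_gt0 : (0 < m)%N) :
  Freiman (ideal_pow (maxideal K n) m) <->
  m = 1 \/ (n <= 2)%N \/ n = 3 /\ m = 2.
Proof.
by rewrite (Freiman_order_ge m_gt0 (@order_ge_maxpow K n m)) all_small_exists //; lia.
Qed.
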